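(* The group $\mathcal{H}=\langle a,b \mid a^7=b^6=1,\ a^b=a^3\rangle$ is a non-abelian BI-group which is not a CI-group.
   Context: Here $a^b=b^{-1}ab$. For a group $G$ write $G^*=G\setminus\{1\}$. For an inverse closed subset $S\subseteq G^*$ (i.e. $S=S^{-1}$), $Cay(G,S)$ is the simple undirected graph with vertex set $G$ in which $x,y$ are adjacent iff $x^{-1}y\in S$. For a finite group $G$, an inverse closed $S\subseteq G^*$ and a positive integer $\nu$, put $M_\nu^S=\{\sum_{s\in S}\chi(s) \mid \chi \text{ a complex irreducible character of } G,\ \chi(1)=\nu\}$ (a set, not a multiset). A finite group $G$ is a BI-group if for all inverse closed subsets $S,T$ of $G^*$, a graph isomorphism $Cay(G,S)\cong Cay(G,T)$ implies $M_\nu^S=M_\nu^T$ for all positive integers $\nu$. A finite group $G$ is a CI-group if for all inverse closed subsets $S,T$ of $G^*$, $Cay(G,S)\cong Cay(G,T)$ (as graphs) implies $S^\alpha=T$ for some automorphism $\alpha$ of $G$. *)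

(* Defs.v *)
From HB Require Import structures.
From mathcomp Require Import all_boot all_order all_algebra all_fingroup.
From mathcomp Require Import all_solvable all_field all_character.

Set Implicit Arguments.
Unset Strict Implicit.
Unset Printing Implicit Defensive.

Import GRing.Theory.
Local Open Scope group_scope.

Definition graph_iso (V W : finType) (e : rel V) (e' : rel W) : Prop :=
  exists2 f : V -> W, bijective f & forall x y, e' (f x) (f y) = e x y.

Definition inverse_closed (gT : finGroupType) (G : {group gT})
  (S : {set gT}) : Prop := S \subset G^# /\ S^-1 = S.

(* Adjacency relation of Cay(G, S) on the type of elements of G; it is
   irreflexive and symmetric as soon as S is inverse closed in G^#. *)
Definition Cay (gT : finGroupType) (G : {group gT}) (S : {set gT}) :
  rel (subg_of G) := fun x y => (sgval x)^-1 * sgval y \in S.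

(* M_nu^S as a set of character values; algC contains all values of complex
   characters of finite groups. *)
Definition M_set (gT : finGroupType) (G : {group gT}) (nu : nat)
  (S : {set gT}) (z : algC) : Prop :=
  exists2 i : Iirr G, ('chi_i 1%g = nu%:R)%R & (z = \sum_(s in S) 'chi_i s)%R.

Definition BI_group (gT : finGroupType) (G : {group gT}) : Prop :=
  forall S T : {set gT}, inverse_closed G S -> inverse_closed G T ->
  graph_iso (Cay (G := G) S) (Cay (G := G) T) ->
  forall nu : nat, 0 < nu -> forall z, M_set G nu S z <-> M_set G nu T z.

Definition CI_group (gT : finGroupType) (G : {group gT}) : Prop :=
  forall S T : {set gT}, inverse_closed G S -> inverse_closed G T ->
  graph_iso (Cay (G := G) S) (Cay (G := G) T) ->
  exists2 alpha : {perm gT}, alpha \in Aut G & alpha @: S = T.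

(* The finite group with this presentation; [iso] compares finite quotients,
   which determines H up to isomorphism since the presented group is finite
   (the relations bound its order by 42). *)
Definition is_calH (gT : finGroupType) (H : {group gT}) : Prop :=
  H \isog Grp (a : b : (a ^+ 7 = b ^+ 6 = 1, a ^ b = a ^+ 3)).

Lemma is_calH_inhabited :
  exists (gT : finGroupType) (H : {group gT}), is_calH H /\ #|H| = 42.
Proof.
exists (Extremal.gtype 7 6 3), [set: Extremal.gtype 7 6 3]%G.
split; last by rewrite Extremal.card.
have ob : #[Zp1 : 'Z_7] = 7 by rewrite order_Zp1.
have [s sA sE] : exists2 s, s \in Aut <[Zp1 : 'Z_7]> & s Zp1 = Zp1 ^+ 3.
  have un : (3%:R : 'Z_#[Zp1 : 'Z_7])%R \is a GRing.unit.
    by rewrite unitZpE ob.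
  exists (Zp_unitm (FinRing.unit _ un)); first exact: Aut_aut.
  rewrite autE ?cycle_id //=.
  by congr (_ ^+ _); rewrite /= ob.
have isoE := @Extremal.Grp 7 6 3 isT isT.
have {}isoE : [set: Extremal.gtype 7 6 3] \isog
    Grp (a : b : (a ^+ 7, b ^+ 6, a ^ b = a ^+ 3)).
  apply: isoE; exists s; split=> //.
  by have := order_dvdG sA; rewrite card_Aut_cycle ob.
move=> rT K; rewrite isoE; apply: eq_existsb => -[x y] /=.
by rewrite !xpair_eqE.
Qed.

(* Main.v *)
Require Import Defs.
From mathcomp Require Import all_boot all_order all_algebra all_fingroup.
From mathcomp Require Import all_solvable all_field all_character.
From mathcomp Require Import zify.

(** The group is the Frobenius group A ><| B with A = <[a]> of order 7 and
B = <[b]> of order 6 acting faithfully on A, that is AGL(1, 7).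

Why it is a BI-group.  It has six linear characters and exactly one
nonlinear irreducible character psi, of degree 6 (42 = 6 * 1 + 6 ^ 2).
Isomorphic Cayley graphs have similar adjacency matrices, and the adjacency
matrix of Cay(G, S) is the sum over S of the matrices of the regular
representation.  As that representation contains each irreducible one as
often as its degree, the characteristic polynomial is
  prod_(lambda linear) (X - lambda(S)) * P ^+ 6
with P the characteristic polynomial of S in the representation affording
psi ([char_poly_adj_unique_nonlinear]).  Modulo 6, the multiplicity of z as an
eigenvalue therefore counts the linear lambda with lambda(S) = z.  There are
only six linear characters, so the only ambiguity is between counts 0 and 6,
and it is lifted by the principal character, whose value |S| is the valency of
the graph ([perm_eq_count_mod]).  So the graph determines the family of the
lambda(S).  Finally the regular character vanishes on S, which gives
  sum_lambda lambda(S) + psi(1) * psi(S) = 0,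
so psi(S) is determined too.  The argument works for any group with a unique
nonlinear irreducible character whose degree is at least the number of linear
ones ([BI_unique_nonlinear]).

Why it is not a CI-group.  When B is abelian, the involution
u * v |-> u * v^-1 (u in A, v in B) of A ><| B carries Cay(G, S) to a Cayley
graph Cay(G, T) as soon as S is stable under conjugating the A-component of
its elements by squares of B; T is then the image of S
([sdprod_flip_iso]).  Let Q = {a, a^2, a^4}, the orbit of a under b^2, and
  S = Q b^3 u Q b^2 u Q^-1 b^4,   T = Q b^3 u Q^-1 b^2 u Q b^4.
The involution sends S to T.  But an automorphism must map a to some a^u and b
to some a^c b; to map Q b^3 onto itself it needs c = 0 and u a square
modulo 7, and then it preserves Q b^2 instead of mapping it to Q^-1 b^2. *)

Set Implicit Arguments.
Unset Strict Implicit.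
Unset Printing Implicit Defensive.

Import GRing.Theory Num.Theory.
Local Open Scope group_scope.

(** * Multiplicities of sequence entries and of polynomial roots *)

(** Multiplicities in a sequence of size at most d lie between 0 and d, so
residues modulo d fail to separate only 0 from d; a multiplicity d means that
the sequence is constant, hence equal to the common entry c, which rules
out a multiplicity 0 of c on the other side. *)
Lemma perm_eq_count_mod (T : eqType) (d : nat) (s t : seq T) (c : T) :
    size s <= d -> size t = size s -> c \in s -> c \in t ->
    (forall x, count_mem x s = count_mem x t %[mod d]) -> perm_eq s t.
Proof.
have full (u v : seq T) x :
    c \in u -> c \in v -> size u <= d -> count_mem x u = d ->
  count_mem x v = 0 -> False.
  move=> cu cv le_u_d ux /count_memPn/negP; apply.
  have: all (pred1 x) u.
    by rewrite all_count eqn_leq count_size ux.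
  by move/allP/(_ c cu) => /= /eqP <-.
move=> le_s_d eq_size cs ct mod_st; apply/allP => x _ /=; apply/eqP.
have le_s := leq_trans (count_size (pred1 x) s) le_s_d.
have le_t : count_mem x t <= d.
  by rewrite (leq_trans (count_size _ _)) // eq_size.
have le_t_d : size t <= d by rewrite eq_size.
have mod_x := mod_st x.
case: (ltngtP (count_mem x s) d) le_s => // s_x _; last first.
  move: mod_x; rewrite s_x modnn.
  case: (ltngtP (count_mem x t) d) le_t => // t_x _.
  by rewrite modn_small // => /esym t0; case: (full _ _ _ cs ct le_s_d s_x t0).
case: (ltngtP (count_mem x t) d) le_t => // t_x _.
  by move: mod_x; rewrite !modn_small.
move: mod_x; rewrite t_x modnn modn_small // => s0.
by case: (full _ _ _ ct cs le_t_d t_x s0).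
Qed.

Lemma mupXn (F : fieldType) (x : F) (q : {poly F}) n :
  (q != 0)%R -> mup x (q ^+ n)%R = (n * mup x q)%N.
Proof.
move=> nz_q; elim: n => [|n IHn]; first by rewrite mupNroot // root1.
by rewrite exprS mupM ?expf_neq0 // IHn mulSn.
Qed.

(** * Characteristic polynomials in the regular representation *)

Section RepresentationSum.

Local Open Scope ring_scope.
Variables (gT : finGroupType) (G : {group gT}).
Local Notation reprG := (mx_representation algC G).
Implicit Types S T : {set gT}.

Definition repr_sum n (rG : reprG n) S : 'M[algC]_n := \sum_(s in S) rG s.

Lemma char_poly_conj n (B B' A : 'M[algC]_n) :
  B' *m B = 1%:M -> char_poly (B *m A *m B') = char_poly A.
Proof.
move=> B'B; have BB' := mulmx1C B'B.
pose P := map_mx polyC B; pose P' := map_mx polyC B'.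
have PP' : P *m P' = 1%:M by rewrite -map_mxM BB' map_mx1.
rewrite /char_poly /char_poly_mx.
have -> : 'X%:M - map_mx polyC (B *m A *m B') =
    P *m ('X%:M - map_mx polyC A) *m P'.
  rewrite mulmxBr mulmxBl !map_mxM; congr (_ - _).
  by rewrite scalar_mxC -mulmxA PP' mulmx1.
by rewrite !det_mulmx mulrC mulrA -det_mulmx (mulmx1C PP') det1 mul1r.
Qed.

Lemma char_poly_repr_sum_sim n1 n2 (rG1 : reprG n1) (rG2 : reprG n2) S :
    S \subset G -> mx_rsim rG1 rG2 ->
  char_poly (repr_sum rG1 S) = char_poly (repr_sum rG2 S).
Proof.
move=> sSG [B eq_n]; rewrite eq_n in rG1 B *; rewrite row_free_unit => uB homB.
rewrite -(@char_poly_conj _ B (invmx B) (repr_sum rG2 S)) ?mulVmx //.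
congr char_poly.
rewrite /repr_sum mulmx_sumr mulmx_suml; apply: eq_bigr => s Ss.
by rewrite -homB ?mulmxK // (subsetP sSG).
Qed.

(** The matrix of a direct sum is block diagonal. *)
Lemma char_poly_repr_sum_dadd (rG1 rG2 : representation algC G) S :
  char_poly (repr_sum (dadd_grepr rG1 rG2) S) =
  char_poly (repr_sum rG1 S) * char_poly (repr_sum rG2 S).
Proof.
rewrite /char_poly -(det_ublock _ 0) -char_block_diag_mx.
congr (\det (char_poly_mx _)).
rewrite /repr_sum; elim/big_rec3: _ => [|s A B C _ ->].
  by rewrite block_mx0.
by rewrite /= add_block_mx !addr0.
Qed.

Lemma char_poly_repr_sum_dsum I (r : seq I) (P : pred I) rG S :
  char_poly (repr_sum
    (\big[dadd_grepr/grepr0]_(i <- r | P i) rG i : representation algC G) S) =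
  \prod_(i <- r | P i) char_poly (repr_sum (rG i) S).
Proof.
elim/big_rec2: _ => [|i p rG' _ <-]; last exact: char_poly_repr_sum_dadd.
by rewrite /char_poly det_mx00.
Qed.

(** Equal characters afford similar representations, so the decomposition of
the regular character lifts to one of the regular representation. *)
Lemma char_poly_regular S :
    S \subset G ->
  char_poly (repr_sum (regular_repr algC G) S) =
  \prod_(i : Iirr G)
    char_poly (repr_sum 'Chi_i S) ^+ irr_degree (socle_of_Iirr i).
Proof.
move=> sSG.
pose isotypic (i : Iirr G) :=
  muln_grepr (Representation 'Chi_i) (irr_degree (socle_of_Iirr i)).
pose rG := \big[dadd_grepr/grepr0]_i isotypic i.
rewrite (@char_poly_repr_sum_sim _ _ _ rG) //; last first.
  apply/cfRepr_rsimP; rewrite cfReprReg cfReg_sum cfRepr_dsum; apply/eqP.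
  by apply: eq_bigr => i _; rewrite cfRepr_muln irrRepr irr1_degree scaler_nat.
rewrite char_poly_repr_sum_dsum; apply: eq_bigr => i _.
by rewrite /isotypic char_poly_repr_sum_dsum prodr_const card_ord.
Qed.

Lemma char_poly_linear_char i S :
  'chi[G]_i \is a linear_char -> S \subset G ->
  char_poly (repr_sum 'Chi_i S) ^+ irr_degree (socle_of_Iirr i) =
  'X - (\sum_(s in S) 'chi_i s)%:P.
Proof.
move=> lin_i sSG.
have deg1 : irr_degree (socle_of_Iirr i) = 1%N.
  by apply/eqP; rewrite -eqC_nat -irr1_degree lin_char1.
have -> : \sum_(s in S) 'chi_i s = \tr (repr_sum 'Chi_i S).
  rewrite raddf_sum; apply: eq_bigr => s Ss.
  by rewrite -irrRepr cfunE (subsetP sSG).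
move: (repr_sum _ _); rewrite deg1 => A.
rewrite expr1 {1}[A]mx11_scalar char_poly_trig ?mx11_is_trig //.
by rewrite big_ord1 !mxE trace_mx11 mulr1n.
Qed.

End RepresentationSum.

(** * Spectra of Cayley graphs *)

Section CayleySpectrum.

Local Open Scope ring_scope.
Variables (gT : finGroupType) (G : {group gT}).
Implicit Types S T : {set gT}.
Local Notation adj S := (repr_sum (regular_repr algC G) S).

(** This identifies [adj S] with the adjacency matrix of Cay(G, S), for the
enumeration of G used by the regular representation. *)
Lemma adjE S i j :
  S \subset G -> adj S i j = (((enum_val i)^-1 * enum_val j)%g \in S)%:R.
Proof.
move=> sSG; have nbr s : s \in S ->
    (j == gring_index G (enum_val i * s)%g) =
    (s == (enum_val i)^-1 * enum_val j)%g.
  move=> Ss; rewrite -(inj_eq enum_val_inj) gring_indexK; last first.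
    by rewrite groupM ?enum_valP // (subsetP sSG).
  by apply/eqP/eqP => [-> | ->]; rewrite ?mulKg ?mulKVg.
rewrite summxE; set t := (_ * _)%g.
transitivity (\sum_(s in S) (s == t)%:R : algC).
  by apply: eq_bigr => s Ss; rewrite /= !mxE -nbr //=.
have [St | S't] := boolP (t \in S); last first.
  by rewrite big1 // => s Ss; case: eqP S't => // <-; rewrite Ss.
by rewrite (bigD1 t) //= eqxx big1 ?addr0 // => s /andP[_ /negPf ->].
Qed.

Lemma adj_row_sum S i : S \subset G -> \sum_j adj S i j = #|S|%:R.
Proof.
move=> sSG; transitivity (\sum_(s in S) 1 : algC); last by rewrite sumr_const.
under eq_bigr do rewrite summxE.
rewrite exchange_big; apply: eq_bigr => s Ss /=.
under eq_bigr do rewrite !mxE /=.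
rewrite (bigD1 (gring_index G (enum_val i * s)%g)) //= eqxx big1 ?addr0 //.
by move=> j /negPf ->.
Qed.

Lemma Cay_iso_adj S T :
    S \subset G -> T \subset G -> graph_iso (Cay (G := G) S) (Cay (G := G) T) ->
  exists p : {perm 'I_#|G|}, adj S = row_perm p (col_perm p (adj T)).
Proof.
move=> sSG sTG [f f_bij f_hom].
pose g (i : 'I_#|G|) := gring_index G (sgval (f (subg G (enum_val i)))).
have g_val i : enum_val (g i) = sgval (f (subg G (enum_val i))).
  by rewrite gring_indexK ?subgP.
have g_inj : injective g.
  move=> i j /(congr1 enum_val); rewrite !g_val => /val_inj/(bij_inj f_bij).
  by move=> /(congr1 sgval); rewrite !subgK ?enum_valP // => /enum_val_inj.
exists (perm g_inj); apply/matrixP=> i j.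
rewrite mxE [in RHS]mxE !permE !adjE // !g_val.
have := f_hom (subg G (enum_val i)) (subg G (enum_val j)).
by rewrite /Cay !subgK ?enum_valP // => ->.
Qed.

Lemma Cay_iso_char_poly S T :
    S \subset G -> T \subset G -> graph_iso (Cay (G := G) S) (Cay (G := G) T) ->
  char_poly (adj S) = char_poly (adj T).
Proof.
move=> sSG sTG /Cay_iso_adj[] // p ->.
rewrite row_permE col_permE mulmxA char_poly_conj //.
by rewrite -perm_mxM mulVg perm_mx1.
Qed.

(** Row sums of the adjacency matrix are the valency of the graph. *)
Lemma Cay_iso_card S T :
    S \subset G -> T \subset G -> graph_iso (Cay (G := G) S) (Cay (G := G) T) ->
  #|S| = #|T|.
Proof.
move=> sSG sTG /Cay_iso_adj[] // p eqST.
pose i := gring_index G 1; apply/eqP; rewrite -eqC_nat; apply/eqP.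
rewrite -(adj_row_sum i sSG) -(adj_row_sum (p i) sTG) eqST.
by rewrite [RHS](reindex_perm p); apply: eq_bigr => j _; rewrite !mxE.
Qed.

Definition linear_sums S :=
  [seq \sum_(s in S) 'chi_i s
    | i : Iirr G in [pred i | 'chi_i \is a linear_char]].

Lemma linear_sumsP S z :
  reflect (M_set G 1 S z) (z \in linear_sums S).
Proof.
apply: (iffP imageP) => [[i /lin_char1 i1 ->] | [i i1 ->]]; exists i => //.
by rewrite inE [_ \is a linear_char]qualifE /= irr_char i1 eqxx.
Qed.

Section UniqueNonlinear.

Variable i0 : Iirr G.
Hypothesis lin_iff : forall i, ('chi[G]_i \is a linear_char) = (i != i0).

Lemma char_poly_adj_unique_nonlinear S :
    S \subset G ->
  char_poly (adj S) =
  (\prod_(z <- linear_sums S) ('X - z%:P))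
    * char_poly (repr_sum 'Chi_i0 S) ^+ irr_degree (socle_of_Iirr i0).
Proof.
move=> sSG; rewrite char_poly_regular // (bigD1 i0) //= mulrC; congr (_ * _).
rewrite big_image; apply: eq_big => i; rewrite ?inE ?lin_iff //.
by rewrite -lin_iff => lin_i; rewrite char_poly_linear_char.
Qed.

Lemma mu_adj_unique_nonlinear S z :
    S \subset G ->
  mup z (char_poly (adj S)) =
    count_mem z (linear_sums S) %[mod irr_degree (socle_of_Iirr i0)].
Proof.
move=> sSG; rewrite char_poly_adj_unique_nonlinear //; set d := irr_degree _.
have nz_q := monic_neq0 (char_poly_monic (repr_sum 'Chi_i0 S)).
rewrite mupM ?expf_neq0 ?mu_prod_XsubC //; last first.
  by rewrite monic_neq0 // monic_prod_XsubC.
by rewrite mupXn // mulnC addnC modnMDl.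
Qed.

(** The regular character vanishes off 1, hence on S. *)
Lemma nonlinear_sum S :
    inverse_closed G S ->
  'chi_i0 1%g * \sum_(s in S) 'chi_i0 s = - \sum_(z <- linear_sums S) z.
Proof.
case=> sSG _; apply/eqP; rewrite -addr_eq0.
have : \sum_(s in S) cfReg G s = 0.
  apply: big1 => s /(subsetP sSG); rewrite !inE cfRegE.
  by case/andP=> /negPf ->.
rewrite cfReg_sum; under eq_bigr do rewrite sum_cfunE.
rewrite exchange_big /= (bigD1 i0) //=; move/eqP; congr (_ + _ == 0).
  by rewrite mulr_sumr; apply: eq_bigr => s _; rewrite cfunE.
rewrite big_image; apply: eq_big => i; rewrite ?inE ?lin_iff //.
rewrite -lin_iff => /lin_char1 i1.
by apply: eq_bigr => s _; rewrite cfunE i1 mul1r.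
Qed.

Lemma size_linear_sums S : size (linear_sums S) = (Nirr G).-1.
Proof.
rewrite size_image -[in RHS](card_ord (Nirr G)) -(cardC1 i0).
by apply: eq_card => i; rewrite !inE lin_iff.
Qed.

(** The degree bound says that there are at most as many linear characters
as the degree of the nonlinear one, so that the multiplicities of the adjacency
eigenvalues, taken modulo that degree, determine the linear sums. *)
Lemma BI_unique_nonlinear :
  (Nirr G <= (irr_degree (socle_of_Iirr i0)).+1)%N -> BI_group G.
Proof.
move=> le_deg S T icS icT isoST.
have [sSG1 _] := icS; have [sTG1 _] := icT.
have sSG := subset_trans sSG1 (subsetDl _ _).
have sTG := subset_trans sTG1 (subsetDl _ _).
have principal (U : {set gT}) : U \subset G -> #|U|%:R \in linear_sums U.
  move=> sUG; apply/linear_sumsP; exists 0; first by rewrite irr0 cfun11.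
  rewrite -sumr_const; apply: eq_bigr => u Uu.
  by rewrite irr0 cfun1E (subsetP sUG).
have eqL : perm_eq (linear_sums S) (linear_sums T).
  apply: (perm_eq_count_mod (d := irr_degree (socle_of_Iirr i0))
                            (c := #|S|%:R)).
  - by rewrite size_linear_sums -ltnS prednK.
  - by rewrite !size_linear_sums.
  - exact: principal.
  - by rewrite (Cay_iso_card sSG sTG) ?principal.
  move=> z; rewrite -!mu_adj_unique_nonlinear //.
  by rewrite (Cay_iso_char_poly sSG sTG).
have eq0 : \sum_(s in S) 'chi_i0 s = \sum_(t in T) 'chi_i0 t.
  apply: (mulfI (irr1_neq0 i0)).
  by rewrite !nonlinear_sum // (perm_big _ eqL).
move=> nu _ z; have [-> | nu1] := eqVneq nu 1%N.
  split=> /linear_sumsP; rewrite ?(perm_mem eqL) => zT;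
    apply/linear_sumsP => //.
  by rewrite (perm_mem eqL).
(* Characters of degree nu <> 1 are nonlinear. *)
have only0 i : 'chi[G]_i 1%g = nu%:R -> i = i0.
  move=> i1; apply/eqP; apply: contraNT nu1; rewrite -lin_iff => /lin_char1.
  by rewrite i1 => /eqP; rewrite pnatr_eq1.
by split=> -[i i1 ->]; exists i; rewrite // (only0 i i1) eq0.
Qed.

End UniqueNonlinear.
End CayleySpectrum.

(** * Flipping the complement of a semidirect product *)

(** The isomorphism is f : u * v |-> u * v^-1.  For x = u * v and y = u' * v',
put w = u^-1 * u' and t = v^-1 * v'.  Then x^-1 * y = w ^ v * t, whereas
(f x)^-1 * f y = w ^ v^-1 * t^-1: besides the inversion of t, the A-parts differ
by conjugation by the square of v, under which S is stable. *)
Lemma sdprod_flip_iso (gT : finGroupType) (A B G : {group gT})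
    (S T : {set gT}) :
    A ><| B = G -> abelian B ->
    {in A & B, forall u t, (u * t^-1 \in T) = (u * t \in S)} ->
    {in A & B & B, forall u t v, (u ^ (v ^+ 2) * t \in S) = (u * t \in S)} ->
  graph_iso (Cay (G := G) S) (Cay (G := G) T).
Proof.
move=> defG cBB flipS sqS; have [_ defAB nAB tiAB] := sdprodP defG.
pose f x := divgr A B x * (remgr A B x)^-1.
have fM u v : u \in A -> v \in B -> f (u * v) = u * v^-1.
  by move=> Au Bv; rewrite /f divgrMid // remgrMid.
have GP x : x \in G -> exists u v, [/\ u \in A, v \in B & x = u * v].
  by rewrite -defAB => /mulsgP[u v Au Bv ->]; exists u, v.
have Gf x : x \in G -> f x \in G.
  by move=> /GP[u [v [Au Bv ->]]]; rewrite fM // -defAB mem_mulg ?groupV.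
have fK x : x \in G -> f (f x) = x.
  by move=> /GP[u [v [Au Bv ->]]]; rewrite !fM ?groupV ?invgK.
have Cay_f x y :
    x \in G -> y \in G -> ((f x)^-1 * f y \in T) = (x^-1 * y \in S).
  move=> /GP[u [v [Au Bv ->]]] /GP[u' [v' [Au' Bv' ->]]].
  rewrite !fM //.
  pose w := u^-1 * u'; pose t := v^-1 * v'.
  have [Aw Bt] : w \in A /\ t \in B by rewrite !groupM ?groupV.
  have Awv z : z \in B -> w ^ z \in A.
    by move=> Bz; rewrite memJ_norm ?(subsetP nAB).
  have comm_v z : z \in B -> commute v z.
    by move=> Bz; apply: (centsP cBB).
  have -> : (u * v^-1)^-1 * (u' * v'^-1) = w ^ v^-1 * t^-1.
    rewrite /w /t conjgE !invMg !invgK -(comm_v v'^-1) ?groupV //.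
    by rewrite -!mulgA mulKg.
  have -> : (u * v)^-1 * (u' * v') = w ^ v * t.
    by rewrite /w /t conjgE !invMg -!mulgA mulKVg.
  rewrite flipS ?Awv ?groupV //.
  rewrite -(sqS (w ^ v^-1) t v) ?Awv ?groupV // -conjgM expgS expg1.
  by rewrite mulKg.
exists (fun x : subg_of G => subg G (f (sgval x))).
  by apply: inv_bij => x /=; rewrite subgK ?Gf ?subgP // fK ?subgP // sgvalK.
by move=> x y; rewrite /Cay !subgK ?Gf ?subgP // Cay_f ?subgP.
Qed.

(** * The Frobenius group of order 42 *)

(** The relations bound the order of A and B by 7 and 6, so it suffices to
know that the group has order 42; two groups with the same presentation
being images of each other, its order is that of the model. *)
Lemma calH_gens (gT : finGroupType) (H : {group gT}) :
    is_calH H ->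
  exists a b, [/\ <[a]> ><| <[b]> = H, #[a] = 7, #[b] = 6 & a ^ b = a ^+ 3].
Proof.
move=> calH; have oH : #|H| = 42.
  have [rT [K [calK <-]]] := is_calH_inhabited.
  apply/eqP; rewrite eqn_dvd !card_homg //.
    by rewrite calH isoGrp_hom.
  by rewrite calK isoGrp_hom.
have /existsP[[a b]] := isoGrp_hom calH; rewrite /= !xpair_eqE.
case/and4P=> /eqP defH /eqP a7 /eqP b6 /eqP ab; exists a, b.
have nAB : <[b]> \subset 'N(<[a]>).
  by rewrite norms_cycle ab mem_cycle.
have defAB : <[a]> * <[b]> = H by rewrite -defH norm_joinEr.
have leA : #[a] <= 7 by rewrite dvdn_leq // order_dvdn a7.
have leB : #[b] <= 6 by rewrite dvdn_leq // order_dvdn b6.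
have := mul_cardG <[a]> <[b]>; rewrite -!orderE defAB oH.
set I := (_ :&: _) => oAB.
have oI : 0 < #|I| := cardG_gt0 _.
have le_ab6 : #[a] * #[b] <= #[a] * 6 by rewrite leq_mul.
have le_7b : #[a] * #[b] <= 7 * #[b] by rewrite leq_mul.
have [oa ob] : #[a] = 7 /\ #[b] = 6 by split; lia.
split=> //; rewrite sdprodE //; apply: card1_trivg.
by rewrite -[#|_|]/(#|I|); move: oAB; rewrite oa ob; lia.
Qed.

Section Frobenius42.

Variables (gT : finGroupType) (H : {group gT}) (a b : gT).
Hypotheses (defH : <[a]> ><| <[b]> = H) (oa : #[a] = 7) (ob : #[b] = 6).
Hypothesis ab : a ^ b = a ^+ 3.

Lemma eq_expa m n : (a ^+ m == a ^+ n) = (m == n %[mod 7]).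
Proof. by rewrite eq_expg_mod_order oa. Qed.

Lemma eq_expb m n : (b ^+ m == b ^+ n) = (m == n %[mod 6]).
Proof. by rewrite eq_expg_mod_order ob. Qed.

Lemma conj_expa m j : (a ^+ m) ^ (b ^+ j) = a ^+ (m * 3 ^ j).
Proof.
elim: j => [|j IHj]; first by rewrite conjg1 muln1.
by rewrite expgSr conjgM IHj conjXg ab -expgM mulnCA expnS.
Qed.

(** Moving b to the right past a raises a to the power 5, the inverse of 3
modulo 7. *)
Lemma mul_expab i j m n :
  (a ^+ i * b ^+ j) * (a ^+ m * b ^+ n) = a ^+ (i + m * 5 ^ j) * b ^+ (j + n).
Proof.
have -> : a ^+ m = (a ^+ (m * 5 ^ j)) ^ (b ^+ j).
  rewrite conj_expa -mulnA -expnMn; apply/eqP.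
  by rewrite eq_expa -modnMmr -modnXm exp1n muln1.
by rewrite conjgE !expgD !mulgA mulgK.
Qed.

Let sAH : <[a]> \subset H.
Proof. by case/sdprod_context: defH => /normal_sub. Qed.
Let sBH : <[b]> \subset H. Proof. by case/sdprod_context: defH. Qed.
Let tiAB : <[a]> :&: <[b]> = 1. Proof. by case/sdprodP: defH. Qed.
Let Ha : a \in H. Proof. by rewrite -cycle_subG. Qed.
Let Hb : b \in H. Proof. by rewrite -cycle_subG. Qed.

Lemma expabP x :
  x \in H -> exists i j, [/\ i < 7, j < 6 & x = a ^+ i * b ^+ j].
Proof.
rewrite -(sdprodW defH).
case/mulsgP=> _ _ /cyclePmin[i i7 ->] /cyclePmin[j j6 ->] ->.
by exists i, j; rewrite -oa -ob.
Qed.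

(** The commutator of a and b is a ^+ 2, which generates <[a]>. *)
Lemma der1_H : H^`(1) = <[a]>.
Proof.
apply/eqP; rewrite eqEsubset; apply/andP; split.
  apply: der1_min; first by rewrite normal_norm //; case/sdprod_context: defH.
  by rewrite -(isog_abelian (sdprod_isog defH)) cycle_abelian.
have : [~ a, b] ^+ 4 \in H^`(1) by rewrite groupX ?mem_commg.
rewrite commgEl ab [a ^+ 3]expgS mulKg -expgM cycle_subG.
by rewrite (_ : a ^+ (2 * 4) = a) // expgS -oa expg_order mulg1.
Qed.

Lemma index_der1 : #|H : H^`(1)| = 6.
Proof. by rewrite der1_H -divgS // -(sdprod_card defH) -!orderE oa ob. Qed.

Lemma not_abelian_H : ~~ abelian H.
Proof.
apply/negP => /derG1P H1; move: oa.
by rewrite orderE -der1_H H1 cards1.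
Qed.

(** Every element is conjugate to a or to a power of b: the action of B is
transitive on the nontrivial elements of A because 3 is a primitive root
modulo 7, and for a nontrivial t in B the A-conjugates of t exhaust the coset
of A containing t because t fixes no nontrivial element of A. *)
Lemma card_classes_H : #|classes H| <= 7.
Proof.
have repr x : x \in H -> exists2 r, r \in a |: <[b]> & x \in r ^: H.
  move=> /expabP[i [j [i7 j6 ->]]]; have [j0 | jn0] := eqVneq j 0.
    have [i0 | in0] := eqVneq i 0.
      by exists 1; rewrite ?inE ?group1 ?orbT // i0 j0 mulg1 class_refl.
    (* 3 is a primitive root modulo 7. *)
    have [k /eqP eq_k] : exists k, i == 3 ^ k %[mod 7].
      have: has (fun k => i == 3 ^ k %[mod 7]) (iota 0 6).
        by do 7?[case: i i7 in0 => [|i] //= i7 in0].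
      by case/hasP=> k _; exists k.
    exists a; rewrite ?inE ?eqxx //; apply/imsetP; exists (b ^+ k).
      by rewrite groupX.
    rewrite -[a in RHS]expg1 conj_expa mul1n j0 mulg1; apply/eqP.
    by rewrite eq_expa eq_k.
  exists (b ^+ j); first by rewrite inE mem_cycle orbT.
  (* 5 ^ j - 1 is invertible modulo 7, and 6 stands for -1. *)
  have [k /eqP eq_k] : exists k, i == 6 * k + k * 5 ^ j %[mod 7].
    have: has (fun k => i == 6 * k + k * 5 ^ j %[mod 7]) (iota 0 7).
      do 6?[case: j j6 jn0 => [|j] //= j6 jn0];
        by do 7?[case: i i7 => [|i] //= i7].
    by case/hasP=> k _; exists k.
  apply/imsetP; exists (a ^+ k); first by rewrite groupX.
  have -> : (b ^+ j) ^ (a ^+ k) = (a ^+ (6 * k) * b ^+ j) * (a ^+ k * b ^+ 0).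
    rewrite conjgE mulg1 mulgA; congr (_ * _ * _); apply/eqP.
    by rewrite eq_invg_mul -expgD -mulSn -oa expgM expg_order expg1n.
  by rewrite mul_expab addn0; congr (_ * _); apply/eqP; rewrite eq_expa eq_k.
apply: leq_trans (_ : #|[set r ^: H | r in a |: <[b]>]| <= _).
  apply/subset_leq_card/subsetP => _ /imsetP[x /repr[r rP xr] ->].
  by apply/imsetP; exists r => //; apply: class_eqP.
apply: leq_trans (leq_imset_card _ _) _.
by rewrite (leq_trans (leq_card_setU _ _).1) // cards1 -orderE ob.
Qed.

(** There are 6 linear characters among at most 7 irreducible ones, and the
squares of the degrees add up to 42. *)
Lemma unique_nonlinear_H :
  exists2 i0 : Iirr H, forall i, ('chi_i \is a linear_char)%R = (i != i0)
                     & irr_degree (socle_of_Iirr i0) = 6.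
Proof.
have [i0 nlin0] : exists i0 : Iirr H, ~~ ('chi_i0 \is a linear_char)%R.
  apply/existsP; rewrite -negb_forall; apply: contra not_abelian_H.
  by move/forallP/char_abelianP.
have nlin1 : #|[predC [pred i : Iirr H | ('chi_i \is a linear_char)%R]]| <= 1.
  rewrite -(leq_add2l #|[pred i : Iirr H | ('chi_i \is a linear_char)%R]|).
  rewrite cardC.
  by rewrite card_lin_irr index_der1 card_ord NirrE card_classes_H.
have lin_iff i : ('chi[H]_i \is a linear_char)%R = (i != i0).
  apply/idP/idP => [lin_i | ]; first by apply: contraNneq nlin0 => <-.
  by apply: contraNT => nlin_i; apply/eqP/(card_le1_eqP nlin1).
exists i0 => //; apply/eqP; rewrite -(eqn_exp2r _ _ (isT : 0 < 2)).
rewrite -eqC_nat natrX -irr1_degree.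
have := irr_sum_square H; rewrite (bigD1 i0) //=.
rewrite (eq_bigr (fun=> 1%R)); last first.
  by move=> i; rewrite -lin_iff => /lin_char1 ->; rewrite expr1n.
rewrite sumr_const -(eq_card lin_iff) card_lin_irr index_der1.
rewrite -(sdprod_card defH) -!orderE oa ob.
move/(canRL (addrK _)) ->.
by rewrite -natrB.
Qed.

Lemma BI_H : BI_group H.
Proof.
have [i0 lin_iff deg0] := unique_nonlinear_H.
by apply: (BI_unique_nonlinear lin_iff); rewrite deg0 NirrE card_classes_H.
Qed.

(** * A pair of connection sets that no automorphism exchanges *)

Let Q : {set gT} := [set a; a ^+ 2; a ^+ 4].

(** The coset of b ^+ 4 = b ^- 2 is filled so as to make the set inverse closed
when b ^+ 2 normalises Y; the coset of b ^+ 3 consists of involutions. *)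
Definition conn (Y : {set gT}) : {set gT} :=
  Q :* b ^+ 3 :|: Y :* b ^+ 2 :|: Y^-1 :* b ^+ 4.

Let sQA : Q \subset <[a]>.
Proof. by rewrite !subUset !sub1set cycle_id !mem_cycle. Qed.

Let nQb2 : b ^+ 2 \in 'N(Q).
Proof.
have sq m n : m * 3 ^ 2 == n %[mod 7] -> (a ^+ m) ^ (b ^+ 2) = a ^+ n.
  by move=> mn; rewrite conj_expa; apply/eqP; rewrite eq_expa.
apply/normP; rewrite /Q !conjUg !conjg_set1 -[a]expg1 -!expgM.
rewrite (sq 1%N 2) // (sq _ 4 (isT : 1 * 2 * 3 ^ 2 == 4 %[mod 7])).
rewrite (sq _ 1%N (isT : 1 * 4 * 3 ^ 2 == 1 %[mod 7])).
by apply/setP=> x; rewrite !inE; do 3?case: eqP.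
Qed.

Let b3_inv u : u \in <[a]> -> u ^ (b ^+ 3) = u^-1.
Proof.
case/cycleP=> i ->; apply/eqP; rewrite conj_expa eq_sym eq_invg_mul -expgD.
by rewrite -mulnS -(expg0 a) eq_expa -modnMmr muln0.
Qed.

Lemma mem_coset_expb u t (Y : {set gT}) n :
  u \in <[a]> -> t \in <[b]> -> Y \subset <[a]> ->
  (u * t \in Y :* b ^+ n) = (u \in Y) && (t == b ^+ n).
Proof.
move=> Au Bt sYA.
apply/rcosetP/andP => [[y Yy] | [Yu /eqP ->]]; last by exists u.
have Ay := subsetP sYA y Yy; move=> eq_ut.
have Bbn : b ^+ n \in <[b]> by apply: mem_cycle.
move: (congr1 (divgr <[a]> <[b]>) eq_ut) (congr1 (remgr <[a]> <[b]>) eq_ut).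
by rewrite !divgrMid ?remgrMid //= => -> ->.
Qed.

Lemma inv_expb t j k : j + k = 6 -> (t^-1 == b ^+ j) = (t == b ^+ k).
Proof.
move=> jk; rewrite -(inj_eq invg_inj) invgK; congr (_ == _); apply/eqP.
by rewrite eq_invg_mul -expgD jk -ob expg_order.
Qed.

Lemma mem_conn u t (Y : {set gT}) :
  u \in <[a]> -> t \in <[b]> -> Y \subset <[a]> ->
  (u * t \in conn Y) = [|| (u \in Q) && (t == b ^+ 3),
    (u \in Y) && (t == b ^+ 2) | (u^-1 \in Y) && (t == b ^+ 4)].
Proof.
move=> Au Bt sYA; have sYA' : Y^-1 \subset <[a]> by rewrite inv_subG.
by rewrite 2!inE !mem_coset_expb // mem_invg orbA.
Qed.

Lemma inverse_closed_conn (Y : {set gT}) :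
  Y \subset <[a]> -> b ^+ 2 \in 'N(Y) -> inverse_closed H (conn Y).
Proof.
move=> sYA nYb2.
have sYA' : Y^-1 \subset <[a]> by rewrite inv_subG.
have sconnH : conn Y \subset H.
  by rewrite !subUset !mul_subG ?sub1set ?groupX // (subset_trans _ sAH).
split.
  rewrite subsetD1 sconnH -(mulg1 1) mem_conn ?group1 //.
  by rewrite -(expg0 b) !eq_expb !andbF.
apply/setP=> x; rewrite mem_invg.
have [Hx | H'x] := boolP (x \in H); last first.
  by rewrite !(contraNF (subsetP sconnH _)) ?groupV.
move: Hx; rewrite -(sdprodW defH) => /mulsgP[u t Au Bt ->{x}].
have Atu : (u^-1) ^ t \in <[a]>.
  by rewrite memJ_norm ?groupV // (subsetP _ t Bt) //; case/sdprodP: defH.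
have -> : (u * t)^-1 = (u^-1) ^ t * t^-1 by rewrite conjgE invMg mulgA mulgK.
rewrite !mem_conn ?groupV // (@inv_expb t 3 3) // (@inv_expb t 2 4) //.
rewrite (@inv_expb t 4 2) // -conjVg invgK; congr (_ || _).
  by case: eqP => [->|]; rewrite ?andbF // b3_inv ?groupV // invgK.
rewrite orbC; congr (_ || _); case: eqP => [->|]; rewrite ?andbF //.
  by rewrite memJ_norm.
by rewrite (expgM b 2 2) memJ_norm ?(groupX 2 nYb2).
Qed.

(** Inverting the B-components exchanges the cosets of b ^+ 2 and b ^+ 4 and
fixes that of b ^+ 3, which amounts to replacing Y by Y^-1. *)
Lemma conn_iso (Y : {set gT}) :
  Y \subset <[a]> -> b ^+ 2 \in 'N(Y) ->
  graph_iso (Cay (G := H) (conn Y)) (Cay (G := H) (conn Y^-1)).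
Proof.
move=> sYA nYb2; have sYA' : Y^-1 \subset <[a]> by rewrite inv_subG.
apply: (sdprod_flip_iso defH (cycle_abelian b)) => [u t Au Bt | u t v Au Bt].
  rewrite !mem_conn ?groupV // !mem_invg invgK (@inv_expb t 3 3) //
    (@inv_expb t 2 4) // (@inv_expb t 4 2) //.
  by congr (_ || _); rewrite orbC.
case/cycleP=> j ->; rewrite -expgM mulnC expgM.
have nA : b ^+ 2 ^+ j \in 'N(<[a]>).
  rewrite -expgM (subsetP (_ : <[b]> \subset _)) ?mem_cycle //.
  by case/sdprodP: defH.
rewrite !mem_conn ?memJ_norm ?(groupX j nQb2) ?(groupX j nYb2) //.
by rewrite -conjVg memJ_norm ?(groupX j nYb2).
Qed.

(** An automorphism alpha maps a to a power a ^+ u, and the relation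
a ^ b = a ^+ 3 forces b to be mapped into the coset of b, to a ^+ c * b say.
Then a ^+ q * b ^+ 3 goes to a ^+ (u * q + 3 * c) * b ^+ 3 and a ^+ q * b ^+ 2
goes to a ^+ (u * q + 6 * c) * b ^+ 2.  If the first maps Q to Q then adding
up the exponents, whose sum over Q is 0 modulo 7, gives c = 0 and u in
{1, 2, 4}; hence the second cannot map Q to Q^-1. *)
Lemma conn_not_aut (alpha : {perm gT}) :
  alpha \in Aut H -> alpha @: conn Q <> conn Q^-1.
Proof.
move=> Aut_alpha imS; pose f := autm Aut_alpha.
have fA : f @* <[a]> = <[a]>.
  have /charP[_] : <[a]> \char H by rewrite -der1_H der_char.
  by apply; rewrite ?injm_autm ?im_autm.
have [u u7 fa] : exists2 u, u < 7 & alpha a = a ^+ u.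
  have : f a \in <[a]> by rewrite -fA mem_morphim ?cycle_id.
  by case/cyclePmin=> u; rewrite oa => u7 fa; exists u.
have [c [k [c7 k6 fb]]] :
  exists c k, [/\ c < 7, k < 6 & alpha b = a ^+ c * b ^+ k].
  by apply: expabP; rewrite -[alpha b]/(f b) -(im_autm Aut_alpha) mem_morphim.
have alphaM : {in H &, {morph alpha : x y / x * y}} by exact: (morphM f).
have alphaX n x : x \in H -> alpha (x ^+ n) = alpha x ^+ n.
  by move=> Hx; apply: (morphX f).
have u0 : u != 0.
  apply/eqP=> u0; have : a == 1.
    by apply/eqP/(@perm_inj _ alpha); rewrite fa u0; apply/esym/(morph1 f).
  by rewrite -order_eq1 oa.
have k1 : k = 1%N.
  have : u * 3 ^ k == u * 3 %[mod 7].
    have : alpha (a ^ b) = alpha (a ^+ 3) by rewrite ab.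
    have -> : alpha (a ^ b) = alpha a ^ alpha b by apply: (morphJ f).
    rewrite alphaX // fa fb conjgM.
    have -> : (a ^+ u) ^ (a ^+ c) = a ^+ u.
      by rewrite conjgE -expgD addnC expgD mulKg.
    by rewrite conj_expa -expgM => /eqP; rewrite eq_expa.
  clear fa fb; move: u u7 u0 k k6.
  by do 7?[case=> //]; move=> _ _; do 6?[case=> //].
have fb1 : alpha b = a ^+ c * b ^+ 1 by rewrite fb k1.
have fb2 : alpha (b ^+ 2) = a ^+ (c * 6) * b ^+ 2.
  by rewrite alphaX // expgS expg1 fb1 mul_expab; congr (a ^+ _ * _); lia.
(* The factor 31 = 1 + 5 + 5 ^ 2 is 3 modulo 7. *)
have fb3 : alpha (b ^+ 3) = a ^+ (c * 31) * b ^+ 3.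
  rewrite {1}expgSr alphaM ?groupX // fb2 fb1 mul_expab.
  by rewrite -mulnDr.
have memQ m : (a ^+ m \in Q) = (m %% 7 \in [:: 1; 2; 4]%N).
  by rewrite !inE -[X in _ == X]expg1 !eq_expa orbA.
have sQVA : Q^-1 \subset <[a]> by rewrite inv_subG.
have in3 q : a ^+ q \in Q -> (u * q + c * 31) %% 7 \in [:: 1; 2; 4]%N.
  move=> Qq; have : alpha (a ^+ q * b ^+ 3) \in conn Q^-1.
    by rewrite -imS imset_f // mem_conn ?mem_cycle // Qq eqxx.
  rewrite alphaM ?groupX // alphaX // fa fb3 -expgM mulgA -expgD.
  by rewrite mem_conn ?mem_cycle // eqxx !eq_expb !andbF andbT !orbF memQ.
have in2 q : a ^+ q \in Q -> (6 * (u * q + c * 6)) %% 7 \in [:: 1; 2; 4]%N.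
  move=> Qq; have : alpha (a ^+ q * b ^+ 2) \in conn Q^-1.
    by rewrite -imS imset_f // mem_conn ?mem_cycle // Qq eqxx orbT.
  rewrite alphaM ?groupX // alphaX // fa fb2 -expgM mulgA -expgD.
  rewrite mem_conn ?mem_cycle // eqxx !eq_expb !andbF andbT !orbF mem_invg.
  rewrite -memQ; congr (_ \in Q); apply/eqP; rewrite eq_invg_mul -expgD.
  by rewrite -mulSn -oa expgM expg_order expg1n.
have inQ q : q \in [:: 1; 2; 4]%N -> a ^+ q \in Q.
  by rewrite memQ !inE => /or3P[] /eqP ->.
move: (in3 1%N (inQ 1%N isT)) (in3 2 (inQ 2 isT)) (in3 4 (inQ 4 isT)).
move: (in2 1%N (inQ 1%N isT)).
clear -u7 c7.
by move: u u7 c c7; do 7?[case=> //]; move=> _; do 7?[case=> //].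
Qed.

Lemma not_CI_H : ~ CI_group H.
Proof.
have sQVA : Q^-1 \subset <[a]> by rewrite inv_subG.
have nQVb2 : b ^+ 2 \in 'N(Q^-1).
  apply/normP/setP=> x; rewrite mem_conjg !mem_invg -conjVg.
  by rewrite memJ_norm ?groupV.
move=> CI; have [] := CI (conn Q) (conn Q^-1).
- exact: inverse_closed_conn.
- exact: inverse_closed_conn.
- exact: conn_iso.
by move=> alpha Aut_alpha /(conn_not_aut Aut_alpha).
Qed.

End Frobenius42.

Theorem theorem1p6 (gT : finGroupType) (H : {group gT}) :
  is_calH H -> ~~ abelian H /\ BI_group H /\ ~ CI_group H.
Proof.
case/calH_gens=> a [b [defH oa ob ab]]; split.
  exact: (not_abelian_H defH oa ab).
by split; [apply: (BI_H defH oa ob ab) | apply: (not_CI_H defH oa ob ab)].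
Qed.
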